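(* Let $m\in\mathbb{N}$ and $c\in[0,1)$ be fixed. Let $\Lambda$, $A$ and $B$ be closed subsets of $\mathbb{E}$ and let $\bar x\in S\subset A\cap B\cap\Lambda$. Suppose that there is $\rho>0$ such that any alternating projections sequence $(x_k)_{k\in\mathbb{N}}$ starting at a point $x_0\in A\cap\Lambda$ with $\|x_0-\bar x\|<\rho$ is contained in $\Lambda$, converges R-linearly with rate $c$ to a point $\tilde x\in S$, say $\|x_k-\tilde x\|\le\gamma c^k$ for all $k\in\mathbb{N}$ with some $\gamma>0$ (where $\tilde x$ and $\gamma$ may depend on the sequence), and, whenever $x_0\notin S$ with $\operatorname{dist}(x_0,S)>0$, there is an index $k_1\le m$ such that $$\operatorname{dist}(x_{k_1},S)\le\|x_{k_1}-\tilde x\|\le\gamma c^{k_1}\le c\,\operatorname{dist}(x_0,S).$$ Then the collection of sets $\{A,B\}$ is subtransversal at $\bar x$ relative to $\Lambda$ with constant $\mathrm{sr}'[A,B](\bar x)\le\frac{2m}{1-c}$.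
   Context: $\mathbb{E}$ is a Euclidean space; $\operatorname{dist}(x,C):=\inf_{a\in C}\|x-a\|$; $\mathbb{B}_\delta(x)$ is the open ball. The projector onto a closed set $C$ is $P_Cx:=\operatorname{argmin}_{a\in C}\|a-x\|$ (set-valued). Alternating projections: a sequence $(x_k)$ with $x_{k+1}\in P_AP_Bx_k$ for all $k\in\mathbb{N}$, i.e. there are $b_k\in P_Bx_k$ with $x_{k+1}\in P_Ab_k$. R-linear convergence to $\tilde x$ with rate $c\in[0,1)$: there is $\gamma>0$ with $\|x_k-\tilde x\|\le\gamma c^k$ for all $k\in\mathbb{N}$. Subtransversality (at a common point): $\{A,B\}$ is subtransversal at $\bar x\in A\cap B$ relative to $\Lambda$ if there are $\delta>0$, $\kappa\ge0$ with $\operatorname{dist}(x,A\cap B\cap\Lambda)\le\kappa\max\{\operatorname{dist}(x,A),\operatorname{dist}(x,B)\}$ for all $x\in\mathbb{B}_\delta(\bar x)\cap\Lambda$. Equivalently, there are $\delta>0$, $\kappa\ge0$ with $$\operatorname{dist}(x,A\cap B\cap\Lambda)\le\kappa\operatorname{dist}(x,B)\quad\forall x\in A\cap\mathbb{B}_\delta(\bar x)\cap\Lambda;\qquad( * )$$ $\mathrm{sr}'[A,B](\bar x)$ denotes the infimum of all $\kappa\ge0$ for which $( * )$ holds for some $\delta>0$.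
   Formalization: Subtransversality relative to Λ is taken in form ( * ) (points of A∩Λ only), not the max-form over all of Λ; the two are not equivalent in general and the max-form conclusion fails for A = B = {y=0}, Λ = {y=x²}, x̄ = 0, S = {0}. *)

(* Defs.v *)
From HB Require Import structures.
From mathcomp Require Import all_boot all_order all_algebra.
From mathcomp Require Import all_classical all_reals all_analysis.

Set Implicit Arguments.
Unset Strict Implicit.
Unset Printing Implicit Defensive.
Import Order.TTheory GRing.Theory Num.Theory.
Import numFieldNormedType.Exports.

Local Open Scope classical_set_scope.
Local Open Scope ring_scope.

(* The Euclidean space is 'rV[R]_n.  The norm the library puts on row vectors
   is the sup norm, hence this definition.  Both norms induce the same
   topology, so the library's [closed] is the intended notion. *)
Definition enorm (R : realType) (n : nat) (x : 'rV[R]_n) : R :=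
  Num.sqrt (\sum_(i < n) x 0 i ^+ 2).

(* Meaningful for nonempty C only ([inf set0 = 0]); every set whose distance
   is taken below contains the reference point xbar. *)
Definition dist (R : realType) (n : nat) (x : 'rV[R]_n)
    (C : set 'rV[R]_n) : R :=
  inf [set enorm (x - a) | a in C].

Definition proj (R : realType) (n : nat) (C : set 'rV[R]_n)
    (x : 'rV[R]_n) : set 'rV[R]_n :=
  [set a | C a /\ forall a', C a' -> enorm (a - x) <= enorm (a' - x)].

Definition alternating_projections (R : realType) (n : nat)
    (A B : set 'rV[R]_n) (x : nat -> 'rV[R]_n) : Prop :=
  forall k : nat, exists2 b, proj B (x k) b & proj A b (x k.+1).

Definition Rlinear_bound (R : realType) (n : nat) (x : nat -> 'rV[R]_n)
    (xt : 'rV[R]_n) (c gamma : R) : Prop :=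
  0 < gamma /\ forall k : nat, enorm (x k - xt) <= gamma * c ^+ k.

Definition subtransversal_const (R : realType) (n : nat)
    (A B L : set 'rV[R]_n) (xbar : 'rV[R]_n) (kappa : R) : Prop :=
  0 <= kappa /\
  exists2 delta : R, 0 < delta &
    forall x, A x -> enorm (x - xbar) < delta -> L x ->
      dist x (A `&` B `&` L) <= kappa * dist x B.

(* This is the form of relative subtransversality that tests points of A only,
   the one the constant [sr'] refers to.  The inequality
     dist x (A `&` B `&` L) <= kappa * max (dist x A) (dist x B)
   for all x in L near xbar implies it, and is equivalent to it if L contains A
   near xbar, but not in general: with A = B the horizontal axis of the plane,
   L the parabola y = x^2 and xbar = 0, only the form below holds. *)
Definition subtransversal (R : realType) (n : nat)
    (A B L : set 'rV[R]_n) (xbar : 'rV[R]_n) : Prop :=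
  A xbar /\ B xbar /\ exists kappa : R, subtransversal_const A B L xbar kappa.

(* Extended-real infimum, so that it is +oo if there is no constant. *)
Definition sr' (R : realType) (n : nat)
    (A B L : set 'rV[R]_n) (xbar : 'rV[R]_n) : \bar R :=
  ereal_inf [set kappa%:E | kappa in subtransversal_const A B L xbar].

(* Main.v *)
Require Import Defs.
From HB Require Import structures.
From mathcomp Require Import all_boot all_order all_algebra.
From mathcomp Require Import all_classical all_reals all_analysis.
From mathcomp Require Import ring lra.

Set Implicit Arguments.
Unset Strict Implicit.
Unset Printing Implicit Defensive.
Import Order.TTheory GRing.Theory Num.Theory.
Import numFieldNormedType.Exports.
Local Open Scope classical_set_scope.
Local Open Scope ring_scope.

(** The hypothesis says that within [m] cycles of the method the distance to
    [S] drops by the factor [c], so the iterates must have travelled at least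
    [(1 - c) * dist x_0 S] by then.  But the method cannot move fast: one cycle
    goes from [x_k] in [A] to a nearest point [b_k] of [B] and then to a point
    of [A] nearest to [b_k], which is no farther from [b_k] than [x_k] was.
    Hence the cycle has length at most [2 * dist x_k B], and it does not
    increase the distance to [B] ([proj_cycle]).  Summing up, [m] cycles
    cover at most [2 * m * dist x_0 B]
    ([alternating_projections_displacement]), so
      [(1 - c) * dist x_0 S <= 2 * m * dist x_0 B],
    and [S] lies in the intersection of the three sets.  This is the claimed
    estimate at the point [x_0], which was any point of [A] and [L] near [xbar],
    provided that some alternating projections sequence starts there; it does
    because nearest points of nonempty closed sets exist ([proj_nonempty]). *)

(** * The Euclidean norm on row vectors *)

Lemma enorm_ge0 (R : realType) (n : nat) (x : 'rV[R]_n) : 0 <= enorm x.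
Proof. exact: sqrtr_ge0. Qed.

Lemma enorm0 (R : realType) (n : nat) : enorm (0 : 'rV[R]_n) = 0.
Proof. by rewrite /enorm big1 ?sqrtr0// => i _; rewrite mxE expr0n. Qed.

Lemma enormN (R : realType) (n : nat) (x : 'rV[R]_n) : enorm (- x) = enorm x.
Proof. by rewrite /enorm; under eq_bigr do rewrite mxE sqrrN. Qed.

Lemma enormB (R : realType) (n : nat) (x y : 'rV[R]_n) :
  enorm (x - y) = enorm (y - x).
Proof. by rewrite -opprB enormN. Qed.

Lemma enorm_sqr (R : realType) (n : nat) (x : 'rV[R]_n) :
  enorm x ^+ 2 = \sum_(i < n) x 0 i ^+ 2.
Proof. by rewrite sqr_sqrtr// sumr_ge0// => i _; exact: sqr_ge0. Qed.

Lemma coord_le_enorm (R : realType) (n : nat) (x : 'rV[R]_n) (i : 'I_n) :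
  `|x 0 i| <= enorm x.
Proof.
rewrite -(@ler_pXn2r _ 2)// ?nnegrE ?enorm_ge0// enorm_sqr.
rewrite real_normK ?num_real//.
by rewrite (bigD1 i)//= lerDl sumr_ge0// => j _; exact: sqr_ge0.
Qed.

Lemma enorm0_coord (R : realType) (n : nat) (x : 'rV[R]_n) (i : 'I_n) :
  enorm x = 0 -> x 0 i = 0.
Proof.
by move=> x0; apply/eqP; rewrite -normr_le0 -x0; exact: coord_le_enorm.
Qed.

(** Cauchy-Schwarz: sum over [i] the inequality
    [2 * (|y| x_i) * (|x| y_i) <= (|y| x_i)^2 + (|x| y_i)^2], then cancel
    [2 |x| |y|], which is legitimate unless one of the vectors is zero. *)
Lemma dot_le_enorm (R : realType) (n : nat) (x y : 'rV[R]_n) :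
  \sum_(i < n) x 0 i * y 0 i <= enorm x * enorm y.
Proof.
have [x0|xn0] := eqVneq (enorm x) 0.
  by rewrite big1 ?x0 ?mul0r// => i _; rewrite enorm0_coord ?mul0r.
have [y0|yn0] := eqVneq (enorm y) 0.
  by rewrite big1 ?y0 ?mulr0// => i _; rewrite (enorm0_coord i y0) mulr0.
have xgt0 : 0 < enorm x by rewrite lt_neqAle eq_sym xn0 enorm_ge0.
have ygt0 : 0 < enorm y by rewrite lt_neqAle eq_sym yn0 enorm_ge0.
have xy0 : 0 < 2 * (enorm x * enorm y) by rewrite !mulr_gt0.
rewrite -(ler_pM2l xy0) mulr_sumr.
have -> : 2 * (enorm x * enorm y) * (enorm x * enorm y) =
    \sum_(i < n) (enorm y ^+ 2 * x 0 i ^+ 2 + enorm x ^+ 2 * y 0 i ^+ 2).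
  by rewrite big_split -!mulr_sumr -!enorm_sqr/=; ring.
apply: ler_sum => i _; rewrite -subr_ge0.
have -> : enorm y ^+ 2 * x 0 i ^+ 2 + enorm x ^+ 2 * y 0 i ^+ 2 -
    2 * (enorm x * enorm y) * (x 0 i * y 0 i) =
    (enorm y * x 0 i - enorm x * y 0 i) ^+ 2 by ring.
exact: sqr_ge0.
Qed.

Lemma ler_enormD (R : realType) (n : nat) (x y : 'rV[R]_n) :
  enorm (x + y) <= enorm x + enorm y.
Proof.
rewrite -(@ler_pXn2r _ 2)// ?nnegrE ?addr_ge0 ?enorm_ge0//.
have -> : enorm (x + y) ^+ 2 =
    enorm x ^+ 2 + 2 * \sum_(i < n) x 0 i * y 0 i + enorm y ^+ 2.
  rewrite !enorm_sqr mulr_sumr -!big_split/=.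
  by apply: eq_bigr => i _; rewrite mxE; ring.
have := dot_le_enorm x y.
by rewrite sqrrD -mulr_natl; lra.
Qed.

Lemma ler_enorm_distD (R : realType) (n : nat) (y x z : 'rV[R]_n) :
  enorm (x - z) <= enorm (x - y) + enorm (y - z).
Proof. by rewrite -[x - z](subrKA y) ler_enormD. Qed.

Lemma enorm_continuous (R : realType) (n : nat) :
  continuous (@enorm R n).
Proof.
move=> x; apply: (@continuous_comp _ _ _
  (fun x : 'rV[R]_n => \sum_(i < n) x 0 i ^+ 2)); last exact: sqrt_continuous.
apply: continuous_big => [|i _ v]; first exact: add_continuous.
apply: (@continuous_comp _ _ _ (fun v : 'rV[R]_n => v 0 i)
  (fun t : R => t ^+ 2)).
  exact: coord_continuous.
exact: exprn_continuous.
Qed.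

(** * Distances and nearest points *)

Lemma has_lbound_dist (R : realType) (n : nat) (x : 'rV[R]_n)
    (C : set 'rV[R]_n) : has_lbound [set enorm (x - a) | a in C].
Proof. by exists 0 => _ [a _ <-]; exact: enorm_ge0. Qed.

Lemma dist_le (R : realType) (n : nat) (x a : 'rV[R]_n) (C : set 'rV[R]_n) :
  C a -> dist x C <= enorm (x - a).
Proof. by move=> Ca; apply: ge_inf; [exact: has_lbound_dist|exists a]. Qed.

Lemma dist_ge (R : realType) (n : nat) (x : 'rV[R]_n) (C : set 'rV[R]_n)
    (r : R) :
  C !=set0 -> (forall a, C a -> r <= enorm (x - a)) -> r <= dist x C.
Proof.
move=> [a Ca] rC; apply: lb_le_inf; first by exists (enorm (x - a)), a.
by move=> _ [b Cb <-]; exact: rC.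
Qed.

Lemma dist_ge0 (R : realType) (n : nat) (x : 'rV[R]_n) (C : set 'rV[R]_n) :
  C !=set0 -> 0 <= dist x C.
Proof. by move=> C0; apply: dist_ge => // a _; exact: enorm_ge0. Qed.

Lemma dist_subset (R : realType) (n : nat) (x : 'rV[R]_n)
    (C D : set 'rV[R]_n) :
  C !=set0 -> C `<=` D -> dist x D <= dist x C.
Proof. by move=> C0 CD; apply: dist_ge => // a /CD; exact: dist_le. Qed.

Lemma dist_le_enormD (R : realType) (n : nat) (x y : 'rV[R]_n)
    (C : set 'rV[R]_n) :
  C !=set0 -> dist x C <= enorm (x - y) + dist y C.
Proof.
move=> C0; rewrite -lerBlDl; apply: dist_ge => // a Ca.
rewrite lerBlDl; apply: le_trans (ler_enorm_distD y x a).
exact: dist_le.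
Qed.

Lemma proj_dist (R : realType) (n : nat) (C : set 'rV[R]_n)
    (x b : 'rV[R]_n) :
  Defs.proj C x b -> enorm (x - b) = dist x C.
Proof.
move=> [Cb bmin]; apply/eqP; rewrite eq_le dist_le// andbT.
apply: dist_ge; first by exists b.
by move=> a Ca; rewrite enormB [leRHS]enormB; exact: bmin.
Qed.

(** Fix a point [a] of [C].  A minimiser over the part of [C] in the closed cube
    of half-side [enorm (a - x)] around [x] exists by compactness; points of
    [C] outside the cube are farther from [x] than [a] is. *)
Lemma proj_nonempty (R : realType) (n : nat) (C : set 'rV[R]_n)
    (x : 'rV[R]_n) :
  closed C -> C !=set0 -> Defs.proj C x !=set0.
Proof.
move=> clC [a Ca]; set r := enorm (a - x).
pose K : set 'rV[R]_n :=
  [set v | forall i, `[x ord0 i - r, x ord0 i + r]%classic (v ord0 i)].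
have inK v : enorm (v - x) <= r -> K v.
  move=> vr i; rewrite /= in_itv/= -ler_distl.
  by apply: le_trans vr; have := coord_le_enorm (v - x) i; rewrite !mxE.
have cK : compact (K `&` C).
  apply: compact_closedI => //.
  apply: (@rV_compact _ _
    (fun i => `[x ord0 i - r, x ord0 i + r]%classic)) => i.
  exact: segment_compact.
have Ka : (K `&` C) a by split => //; exact: inK.
have shift_cont : continuous (fun v : 'rV[R]_n => v - x).
  by move=> v; apply: continuousB; [exact: cvg_id|exact: cst_continuous].
have cont : {within K `&` C, continuous (fun v => enorm (v - x))}.
  apply: continuous_subspaceT => v.
  apply: (@continuous_comp _ _ _ _ _ v (shift_cont v)).
  exact: enorm_continuous.
have [b /set_mem[_ Cb] bmin] := compact_EVT_min (ex_intro _ a Ka) cK cont.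
exists b; split => // v Cv.
have [vr|rv] := leP (enorm (v - x)) r.
  by apply: bmin; apply/mem_set; split => //; exact: inK.
by apply: le_trans (ltW rv); apply: bmin; exact/mem_set.
Qed.

(** * Alternating projections *)

Lemma alternating_projections_exists (R : realType) (n : nat)
    (A B : set 'rV[R]_n) (x0 : 'rV[R]_n) :
  closed A -> closed B -> A !=set0 -> B !=set0 ->
  exists2 x : nat -> 'rV[R]_n, x 0%N = x0 & alternating_projections A B x.
Proof.
move=> clA clB A0 B0.
have [pA pAP] : {f & forall x, Defs.proj A x (f x)}.
  by apply: (@choice _ _ (Defs.proj A)) => x; exact: proj_nonempty.
have [pB pBP] : {f & forall x, Defs.proj B x (f x)}.
  by apply: (@choice _ _ (Defs.proj B)) => x; exact: proj_nonempty.
exists (fun k => iter k (pA \o pB) x0) => // k.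
by exists (pB (iter k (pA \o pB) x0)); [exact: pBP|exact: pAP].
Qed.

(** Since [x] itself competes for the projection of [b] onto [A], the second
    half of a cycle is no longer than the first; and [b] competes for the
    distance of [y] to [B]. *)
Lemma proj_cycle (R : realType) (n : nat) (A B : set 'rV[R]_n)
    (x b y : 'rV[R]_n) :
  A x -> Defs.proj B x b -> Defs.proj A b y ->
  enorm (x - y) <= 2 * dist x B /\ dist y B <= dist x B.
Proof.
move=> Ax xb [_ /(_ _ Ax) yb]; have := proj_dist xb; case: xb => Bb _ <-.
split; last by apply: le_trans yb; exact: dist_le.
have := ler_enorm_distD b x y; rewrite (enormB b y); lra.
Qed.

Lemma alternating_projections_displacement (R : realType) (n : nat)
    (A B : set 'rV[R]_n) (x : nat -> 'rV[R]_n) :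
  alternating_projections A B x -> A (x 0%N) ->
  forall k, enorm (x 0%N - x k) <= 2 * k%:R * dist (x 0%N) B.
Proof.
move=> xAP Ax0 k.
suff [] : [/\ A (x k), dist (x k) B <= dist (x 0%N) B &
    enorm (x 0%N - x k) <= 2 * k%:R * dist (x 0%N) B] by [].
elim: k => [|k [Axk dk xk]].
  by split=> //; rewrite subrr enorm0 mulr0 mul0r.
have [b xb bx] := xAP k.
have [step dS] := proj_cycle Axk xb bx.
split; [by case: bx|exact: le_trans dk|].
have := ler_enorm_distD (x k) (x 0%N) (x k.+1).
by rewrite -natr1; lra.
Qed.

(** * Subtransversality *)

Theorem theorem4p15 (R : realType) (n : nat) (m : nat) (c : R)
    (hc0 : 0 <= c) (hc1 : c < 1)
    (L A B S : set 'rV[R]_n) (xbar : 'rV[R]_n)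
    (hL : closed L) (hA : closed A) (hB : closed B)
    (hxbar : S xbar) (hS : S `<=` A `&` B `&` L)
    (hseq : exists2 rho : R, 0 < rho &
      forall x : nat -> 'rV[R]_n,
        alternating_projections A B x ->
        A (x 0%N) -> L (x 0%N) -> enorm (x 0%N - xbar) < rho ->
        (forall k : nat, L (x k)) /\
        exists xt : 'rV[R]_n, exists gamma : R,
          [/\ S xt,
              Rlinear_bound x xt c gamma &
              ~ S (x 0%N) -> 0 < dist (x 0%N) S ->
              exists k1 : nat,
                [/\ (k1 <= m)%N,
                    dist (x k1) S <= enorm (x k1 - xt),
                    enorm (x k1 - xt) <= gamma * c ^+ k1 &
                    gamma * c ^+ k1 <= c * dist (x 0%N) S]]) :
  subtransversal A B L xbar /\
  (sr' A B L xbar <= (2 * m%:R / (1 - c))%:E)%E.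
Proof.
have S0 : S !=set0 by exists xbar.
have [[Axb Bxb] Lxb] := hS xbar hxbar.
have c1 : 0 < 1 - c by rewrite subr_gt0.
have const : subtransversal_const A B L xbar (2 * m%:R / (1 - c)).
  split; first by rewrite divr_ge0 ?mulr_ge0// ltW.
  have [rho rho0 xP] := hseq; exists rho => // z Az zrho Lz.
  have B0 : B !=set0 by exists xbar.
  apply: le_trans (dist_subset z S0 hS) _.
  (* clear the denominator: [(1 - c) * dist z S <= 2 * m * dist z B] *)
  rewrite mulrAC ler_pdivlMr// mulrC.
  have dB0 := dist_ge0 z B0.
  have m0 : 0 <= 2 * m%:R * dist z B by rewrite !mulr_ge0.
  have [dS|dS] := leP (dist z S) 0.
    by apply: le_trans m0; rewrite pmulr_rle0.
  have A0 : A !=set0 by exists xbar.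
  have [x xz xAP] := alternating_projections_exists z hA hB A0 B0.
  move: xP => /(_ x xAP); rewrite xz => /(_ Az Lz zrho)[_ [xt [gamma [_ _]]]].
  have nS : ~ S z.
    by move=> /(dist_le z); rewrite subrr enorm0 leNgt dS.
  move=> /(_ nS dS)[k [km d1 d2 d3]].
  have disp := alternating_projections_displacement xAP _ k.
  rewrite xz in disp.
  have tri := dist_le_enormD z (x k) S0.
  have mono : 2 * k%:R * dist z B <= 2 * m%:R * dist z B.
    by rewrite ler_wpM2r// ler_wpM2l// ler_nat.
  have := disp Az; lra.
split; first by split => //; split => //; exists (2 * m%:R / (1 - c)).
by apply: ereal_inf_lbound; exists (2 * m%:R / (1 - c)).
Qed.
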